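(* Let $\{\Lambda_{x,j}\in\mathcal{L}(\mathcal{H},\mathcal{K}_{x,j}): x\in\mathcal{X}, j\in J\}$ be a semi-continuous $g$-frame for a Hilbert space $\mathcal{H}$ with respect to a measure space $(\mathcal{X},\mu)$, and let $\{\mathcal{G}_{x,j}: x\in\mathcal{X},j\in J\}$ be an alternate dual frame of it. Then for every measurable $\mathcal{X}_1\subset\mathcal{X}$ (with $\mathcal{X}_1^c=\mathcal{X}\setminus\mathcal{X}_1$) and every $f\in\mathcal{H}$, $$\Big(\int_{\mathcal{X}_1^c}\sum_{j\in J}\langle\mathcal{G}_{x,j}f,\Lambda_{x,j}f\rangle d\mu(x)\Big)+\Big\|\int_{\mathcal{X}_1}\sum_{j\in J}\Lambda_{x,j}^*\mathcal{G}_{x,j}f\,d\mu(x)\Big\|^2=\overline{\Big(\int_{\mathcal{X}_1}\sum_{j\in J}\langle\mathcal{G}_{x,j}f,\Lambda_{x,j}f\rangle d\mu(x)\Big)}+\Big\|\int_{\mathcal{X}_1^c}\sum_{j\in J}\Lambda_{x,j}^*\mathcal{G}_{x,j}f\,d\mu(x)\Big\|^2.$$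
   Context: $\mathcal{H},\mathcal{K}$ are Hilbert spaces, $J$ is a countable index set, $(\mathcal{X},\mu)$ is a measure space with positive measure, $\{\mathcal{K}_{x,j}\}_{x\in\mathcal{X},j\in J}$ is a family of closed subspaces of $\mathcal{K}$, and $\mathcal{L}(\mathcal{H},\mathcal{K}_{x,j})$ is the space of bounded linear operators. A family $\{\Lambda_{x,j}\in\mathcal{L}(\mathcal{H},\mathcal{K}_{x,j})\}$ is a semi-continuous $g$-frame for $\mathcal{H}$ with respect to $(\mathcal{X},\mu)$ if for every $f\in\mathcal{H}$ and $j\in J$ the function $x\mapsto\Lambda_{x,j}(f)$ is measurable on $\mathcal{X}$, and there are constants $A,B>0$ with $A\|f\|^2\le\int_{\mathcal{X}}\sum_{j\in J}\|\Lambda_{x,j}(f)\|^2d\mu(x)\le B\|f\|^2$ for all $f\in\mathcal{H}$. A semi-continuous $g$-frame $\{\mathcal{G}_{x,j}\in\mathcal{L}(\mathcal{H},\mathcal{K}_{x,j})\}$ is an alternate dual frame of $\{\Lambda_{x,j}\}$ if for all $f\in\mathcal{H}$, $f=\int_{\mathcal{X}}\sum_{j}\Lambda_{x,j}^*\mathcal{G}_{x,j}f\,d\mu(x)=\int_{\mathcal{X}}\sum_{j}\mathcal{G}_{x,j}^*\Lambda_{x,j}f\,d\mu(x)$. Vector-valued integrals are understood weakly: $v=\int_{\mathcal{X}_1}\sum_j\Lambda_{x,j}^*\mathcal{G}_{x,j}f\,d\mu(x)$ means $\langle v,g\rangle=\int_{\mathcal{X}_1}\sum_j\langle\mathcal{G}_{x,j}f,\Lambda_{x,j}g\rangle\,d\mu(x)$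 for all $g\in\mathcal{H}$, and similarly with the roles of $\Lambda$ and $\mathcal{G}$ exchanged. The functions $x\mapsto\langle\mathcal{G}_{x,j}f,\Lambda_{x,j}g\rangle$ are measurable. *)

(* Defs.v *)
From HB Require Import structures.
From mathcomp Require Import all_boot all_order all_algebra complex.
From mathcomp Require Import all_classical all_reals all_analysis.
From mathcomp.analysis.showcase Require summability.

Set Implicit Arguments.
Unset Strict Implicit.
Unset Printing Implicit Defensive.

Import Order.TTheory GRing.Theory Num.Theory.
Import numFieldNormedType.Exports.

Local Open Scope classical_set_scope.
Local Open Scope complex_scope.
Local Open Scope ring_scope.

(* Complex Hilbert spaces: the inner product is linear in its first argument
   and conjugate-linear in the second one. *)
HB.mixin Record CompleteNormedModule_isHilbert (R : realType) V
    & CompleteNormedModule R[i] V := {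
  dotp : {dot V for (@Num.conj R[i])} ;
  sqr_norm_dotp : forall u : V, `|u| ^+ 2 = dotp u u
}.

#[short(type="hilbertType")]
HB.structure Definition Hilbert (R : realType) :=
  {V of CompleteNormedModule R[i] V & CompleteNormedModule_isHilbert R V}.

Notation "''[' u , v ]" := (dotp u v) : ring_scope.

(* The norm of a complex normed module takes its values in R[i]. *)
Definition hnorm (R : realType) (V : normedModType R[i]) (v : V) : R :=
  complex.Re `|v|.

Definition closed_subspace (R : realType) (V : normedModType R[i])
    (S : set V) : Prop :=
  closed S /\ submod_closed [in S].

Definition bounded_operator (R : realType) (V W : normedModType R[i])
    (L : {linear V -> W}) : Prop :=
  exists M : R, forall f : V, hnorm (L f) <= M * hnorm f.

Section ComplexIntegral.
Context (R : realType) (d : measure_display) (X : measurableType d).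
Context (mu : {measure set X -> \bar R}) (D : set X).
Implicit Type F : X -> R[i].

Definition complex_measurable F : Prop :=
  measurable_fun D (fun x => complex.Re (F x)) /\
  measurable_fun D (fun x => complex.Im (F x)).

Definition complex_integrable F : Prop :=
  mu.-integrable D (fun x => (complex.Re (F x))%:E) /\
  mu.-integrable D (fun x => (complex.Im (F x))%:E).

Definition complex_integral F : R[i] :=
  Rintegral mu D (fun x => complex.Re (F x)) +i*
  Rintegral mu D (fun x => complex.Im (F x)).

End ComplexIntegral.

(* No enumeration of the countable index set is given, so series are summed
   unconditionally, i.e. along the filter of finite subsets of J. *)
Definition csummable (R : realType) (J : countType) (a : J -> R[i]) : Prop :=
  cvg (summability.partial_sum (a : J -> R[i]^o) @ summability.totally).

Definition csum (R : realType) (J : countType) (a : J -> R[i]) : R[i] :=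
  summability.sum (a : J -> R[i]^o).

Section SemiContinuousGFrame.
Context (R : realType) (d : measure_display) (X : measurableType d).
Context (mu : {measure set X -> \bar R}) (J : countType) (H K : hilbertType R).
Implicit Types (Kxj : X -> J -> set K) (L G : X -> J -> {linear H -> K}).

Definition operator_family Kxj L : Prop :=
  forall x j, bounded_operator (L x j) /\ range (L x j) `<=` Kxj x j.

Definition borel_measurable (u : X -> K) : Prop :=
  forall U : set K, open U -> measurable (u @^-1` U).

Definition frame_integral L (f : H) : \bar R :=
  (\int[mu]_x \esum_(j in [set: J]) ((hnorm (L x j f)) ^+ 2)%:E)%E.

Definition semicontinuous_gframe Kxj L : Prop :=
  [/\ operator_family Kxj L,
      forall (f : H) (j : J), borel_measurable (fun x => L x j f) &
      exists A B : R, [/\ 0 < A, 0 < B &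
        forall f : H, ((A * hnorm f ^+ 2)%:E <= frame_integral L f)%E /\
                      (frame_integral L f <= (B * hnorm f ^+ 2)%:E)%E]].

(* \int_D \sum_j <G_{x,j} f, L_{x,j} g> dmu(x) *)
Definition pairing_integral (D : set X) L G (f g : H) : R[i] :=
  complex_integral mu D (fun x => csum (fun j => '[G x j f, L x j g])).

Definition pairing_integrable (D : set X) L G (f g : H) : Prop :=
  {ae mu, forall x, D x -> csummable (fun j => '[G x j f, L x j g])} /\
  complex_integrable mu D (fun x => csum (fun j => '[G x j f, L x j g])).

(* v = \int_D \sum_j L_{x,j}^* G_{x,j} f dmu(x) in the weak sense *)
Definition is_weak_integral (D : set X) L G (f v : H) : Prop :=
  forall g : H, pairing_integrable D L G f g /\
                '[v, g] = pairing_integral D L G f g.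

Lemma is_weak_integral_unique (D : set X) L G (f v w : H) :
  is_weak_integral D L G f v -> is_weak_integral D L G f w -> v = w.
Proof.
move=> hv hw; have dvw : '[v - w, v - w] = 0.
  by rewrite linearBl /= (hv (v - w)).2 (hw (v - w)).2 subrr.
apply/eqP; rewrite -subr_eq0 -normr_eq0.
by rewrite -sqrf_eq0 sqr_norm_dotp dvw.
Qed.

Definition weak_integral (D : set X) L G (f : H) : H :=
  get [set v | is_weak_integral D L G f v].

Definition alternate_dual Kxj L G : Prop :=
  [/\ semicontinuous_gframe Kxj G,
      forall f : H, is_weak_integral setT L G f f &
      forall f : H, is_weak_integral setT G L f f].

End SemiContinuousGFrame.

(* Main.v *)
(* Riesz representation applied to g |-> int_D sum_j <G_{x,j} f, Lambda_{x,j} g>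
   gives the weak integrals v1 over X1 and v2 over the complement; the required
   bound on that functional is the upper frame bounds of Lambda and G, through
   |Re <u, v>| <= |u|^2 + |v|^2.  Duality says v1 + v2 = f, so that
   <v2, f> + |v1|^2 = <v2, v1> + |v2|^2 + |v1|^2 = <f, v1> + |v2|^2. *)
Require Import Defs.
From HB Require Import structures.
From mathcomp Require Import all_boot all_order all_algebra complex.
From mathcomp Require Import all_classical all_reals all_analysis.
From mathcomp Require Import measurable_realfun ring lra.
From mathcomp Require finmap.
From mathcomp.analysis.showcase Require summability.

Set Implicit Arguments.
Unset Strict Implicit.
Unset Printing Implicit Defensive.

Import Order.TTheory GRing.Theory Num.Theory.
Import numFieldNormedType.Exports.

Local Open Scope classical_set_scope.
Local Open Scope complex_scope.
Local Open Scope ring_scope.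

(** * Real parts, norms as real numbers, and completeness *)

Lemma complex_ReD (R : rcfType) (z w : R[i]) :
  complex.Re (z + w) = complex.Re z + complex.Re w.
Proof. by case: z; case: w. Qed.

Lemma complex_ReN (R : rcfType) (z : R[i]) : complex.Re (- z) = - complex.Re z.
Proof. by case: z. Qed.

Lemma hnormE (R : realType) (V : normedModType R[i]) (v : V) : `|v| = (hnorm v)%:C.
Proof. by rewrite /hnorm RRe_real // normr_real. Qed.

Lemma hnorm_ge0 (R : realType) (V : normedModType R[i]) (v : V) : 0 <= hnorm v.
Proof. by rewrite -lecR -hnormE normr_ge0. Qed.

(** Completeness of [V] is phrased with radii in [R[i]]. A positive element of [R[i]] is real, so
    real radii suffice in both directions. *)
Lemma hnorm_cauchy_cvg (R : realType) (V : completeNormedModType R[i])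
    (u : nat -> V) :
  (forall e : R, 0 < e -> exists N : nat, forall m n,
     (N <= m)%N -> (N <= n)%N -> hnorm (u m - u n) < e) ->
  exists v : V, forall e : R, 0 < e ->
    exists N : nat, forall n, (N <= n)%N -> hnorm (v - u n) < e.
Proof.
move=> hu.
have cu : cauchy (u @ \oo).
  apply/cauchyP => e e0.
  have eR : e = (complex.Re e)%:C by rewrite RRe_real // gtr0_real.
  have [|N hN] := hu (complex.Re e); first by rewrite -ltcR -eR.
  exists (u N); exists N => // n /= Nn.
  rewrite -ball_normE /= hnormE eR ltcR; exact: hN.
have /cauchy_cvg cv := cu.
exists (lim (u @ \oo)) => e e0.
have e0' : 0 < e%:C :> R[i] by rewrite ltcR.
have := @cvgr_dist_lt _ _ _ _ _ _ _ cv _ e0'.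
case=> N _ hN; exists N => m Nm.
by have /= := hN m Nm; rewrite hnormE ltcR.
Qed.

(** * The real inner product underlying a complex Hilbert space *)

Section RealInnerProduct.
Context (R : realType) (H : hilbertType R).
Implicit Types (u v w : H) (t : R).

Definition rdot u v : R := complex.Re '[u, v].

Lemma rdotC u v : rdot u v = rdot v u.
Proof. by rewrite /rdot hermC /= expr0 mul1r; case: '[v, u]. Qed.

Lemma rdotDl u v w : rdot (u + v) w = rdot u w + rdot v w.
Proof. by rewrite /rdot linearDl /= complex_ReD. Qed.

Lemma rdotDr u v w : rdot w (u + v) = rdot w u + rdot w v.
Proof. by rewrite rdotC rdotDl !(rdotC _ w). Qed.

Lemma rdotZl t u v : rdot (t%:C *: u) v = t * rdot u v.
Proof.
rewrite /rdot linearZl_LR /=.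
by case: '[u, v] => a b /=; rewrite mul0r subr0.
Qed.

Lemma rdotZr t u v : rdot u (t%:C *: v) = t * rdot u v.
Proof. by rewrite rdotC rdotZl rdotC. Qed.

Lemma rdotNl u v : rdot (- u) v = - rdot u v.
Proof. by rewrite /rdot linearNl /= complex_ReN. Qed.

Lemma rdotNr u v : rdot u (- v) = - rdot u v.
Proof. by rewrite rdotC rdotNl rdotC. Qed.

Lemma rdot_sqr u : rdot u u = hnorm u ^+ 2.
Proof. by rewrite /rdot -sqr_norm_dotp hnormE -rmorphXn. Qed.

Lemma rdot_ge0 u : 0 <= rdot u u.
Proof. by rewrite rdot_sqr sqr_ge0. Qed.

(** Both |u + v|^2 and |u - v|^2 are nonnegative. With squares on the right, summing over j and
    integrating leads straight to the two frame integrals. *)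
Lemma rdot_le u v : `|rdot u v| <= rdot u u + rdot v v.
Proof.
have hp := rdot_ge0 (u + v); have hm := rdot_ge0 (u - v).
have := rdot_ge0 u; have := rdot_ge0 v.
rewrite !(rdotDl, rdotDr, rdotNl, rdotNr) (rdotC v u) in hp hm *.
rewrite ler_norml => *; lra.
Qed.

End RealInnerProduct.

(** * Riesz representation over the reals, by minimising a quadratic functional *)

Section RealRiesz.
Context (R : realType) (H : hilbertType R) (phi : H -> R) (a b : R).
Context (phiD : forall u v, phi (u + v) = phi u + phi v).
Context (phiZ : forall (t : R) u, phi (t%:C *: u) = t * phi u).
Context (b_gt0 : 0 < b) (phi_le : forall u, phi u <= a + b * rdot u u).

(* Its minimiser represents phi. *)
Let Q u := rdot u u - 2 * phi u.

(* phi_le applied to (2 b)^-1 u, multiplied by 4 b. *)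
Let Q_lb u : - (4 * a * b) <= Q u.
Proof.
have := phi_le ((2 * b)^-1%:C *: u).
rewrite phiZ rdotZl rdotZr /Q => h.
have b2 : 0 < 2 * b by rewrite mulr_gt0.
have : 4 * b * ((2 * b)^-1 * phi u) <=
    4 * b * (a + b * ((2 * b)^-1 * ((2 * b)^-1 * rdot u u))).
  by rewrite ler_wpM2l // mulr_ge0 // ltW.
have -> : 4 * b * ((2 * b)^-1 * phi u) = 2 * phi u by field; rewrite gt_eqF.
have -> : 4 * b * (a + b * ((2 * b)^-1 * ((2 * b)^-1 * rdot u u))) =
    4 * a * b + rdot u u.
  by field; rewrite gt_eqF.
lra.
Qed.

Let Q_add u g t :
  Q (u + t%:C *: g) = Q u + 2 * t * (rdot u g - phi g) + t ^+ 2 * rdot g g.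
Proof.
rewrite /Q phiD phiZ !(rdotDl, rdotDr) !(rdotZl, rdotZr) (rdotC g u).
ring.
Qed.

(** Since [phi] is linear, the parallelogram law gives |u - v|^2 = 2 Q(u) + 2 Q(v) - 4 Q((u + v) /
    2), and [m] bounds the last value from below. Hence near-minimisers of [Q] are close to each
    other. *)
Let Q_parallelogram u v (m : R) : (forall w, m <= Q w) ->
  rdot (u - v) (u - v) <= 2 * (Q u - m) + 2 * (Q v - m).
Proof.
move=> hm; have := hm ((2^-1 : R)%:C *: (u + v)).
rewrite /Q phiZ phiD !(rdotZl, rdotZr) !(rdotDl, rdotDr, rdotNl, rdotNr) (rdotC v u).
lra.
Qed.

(** A minimising sequence of [Q] is Cauchy; at its limit the first-order condition <v, g> = phi(g)
    holds in every direction [g]. *)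
Lemma real_riesz : exists v : H, forall g : H, rdot v g = phi g.
Proof.
pose m := inf (range Q).
have hinf : has_inf (range Q).
  split; first by exists (Q 0), 0.
  by exists (- (4 * a * b)) => _ [u _ <-].
have hm w : m <= Q w by apply: ge_inf; [exact: hinf.2 | exists w].
(* The slack is squared so that [Q_parallelogram] puts [u i] and [u j], for i, j >= N, within 2 / (N
   + 1) of each other. *)
have hex (n : nat) : exists u, Q u < m + n.+1%:R^-1 ^+ 2.
  have [|_ [u _ <-] hu] := @inf_adherent _ (range Q) (n.+1%:R^-1 ^+ 2) _ hinf.
    by rewrite exprn_gt0 // invr_gt0.
  by exists u.
have [u hu] := choice hex.
have [|v hv] := @hnorm_cauchy_cvg R H u.
  move=> e e0; have [N hN] : exists N : nat, 2 / e < N.+1%:R.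
    exists (Num.bound (2 / e)); apply: lt_trans (archi_boundP _) _.
      by rewrite divr_ge0 // ltW.
    by rewrite ltr_nat.
  exists N => i j Ni Nj.
  have hNe : 2 * N.+1%:R^-1 < e.
    by rewrite ltr_pdivrMr // mulrC -ltr_pdivrMr.
  have le_inv k : (N <= k)%N -> k.+1%:R^-1 ^+ 2 <= N.+1%:R^-1 ^+ 2 :> R.
    move=> Nk; rewrite lerXn2r ?nnegrE ?invr_ge0 //.
    by rewrite lef_pV2 ?posrE // ler_nat.
  have := Q_parallelogram (u i) (u j) hm.
  have := hu i; have := hu j; have := le_inv _ Ni; have := le_inv _ Nj.
  rewrite rdot_sqr => h1 h2 h3 h4 h5.
  apply: le_lt_trans hNe.
  rewrite -ler_sqr ?nnegrE ?hnorm_ge0 ?mulr_ge0 ?invr_ge0 // exprMn.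
  move: h1 h2 h3 h4 h5.
  move: (Q (u i)) (Q (u j)) (hnorm _ ^+ 2) (i.+1%:R^-1 ^+ 2)
    (j.+1%:R^-1 ^+ 2) (N.+1%:R^-1 ^+ 2) => *.
  lra.
exists v => g.
have hg0 : 0 <= rdot g g := rdot_ge0 g.
(* Q is within t ^+ 2 of its infimum at u n, so comparing u n with u n +- t g
   bounds |rdot (u n) g - phi g| by a multiple of t. *)
have small (t : R) : 0 < t -> `|rdot v g - phi g| <= t * (2 + rdot g g).
  move=> t0.
  have t20 : 0 < t ^+ 2 by rewrite exprn_gt0.
  have [N hN] := hv _ t0.
  have [M hM] : exists M : nat, M.+1%:R^-1 < t.
    exists (Num.bound t^-1); rewrite invf_plt ?posrE //.
    apply: lt_trans (archi_boundP _) _; first by rewrite invr_ge0 ltW.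
    by rewrite ltr_nat.
  pose n := maxn N M.
  have hvn := hN n (leq_maxl _ _).
  have hn2 : Q (u n) < m + t ^+ 2.
    apply: lt_trans (hu n) _.
    rewrite ltrD2l ltrXn2r ?nnegrE ?invr_ge0 // ?(ltW t0) //.
    apply: le_lt_trans hM; rewrite lef_pV2 ?posrE // ler_nat ltnS; exact: leq_maxr.
  have Qp := hm (u n + t%:C *: g); have Qm := hm (u n + (- t)%:C *: g).
  have : rdot (v - u n) (v - u n) < t ^+ 2.
    by rewrite rdot_sqr ltrXn2r ?nnegrE ?hnorm_ge0 // ltW.
  (* Replacing [u n] by [v] costs <w, g> with w = v - u n. Expanding |w + t g|^2 >= 0 and |w - t
     g|^2 >= 0 bounds 2 t |<w, g>| by |w|^2 + t^2 |g|^2, where |w| < t. *)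
  have := rdot_ge0 (v - u n + t%:C *: g); have := rdot_ge0 (v - u n + (- t)%:C *: g).
  rewrite !Q_add in Qp Qm.
  set w := v - u n.
  rewrite !(rdotDl w, rdotDr w) !(rdotZl, rdotZr) (rdotC g w).
  have -> : rdot v g = rdot w g + rdot (u n) g by rewrite -rdotDl subrK.
  move=> h1 h2 h3.
  rewrite ler_norml; apply/andP; split; rewrite -(ler_pM2l t0); nra.
apply/eqP; rewrite -subr_eq0 -normr_le0.
apply/ler_addgt0Pr => e e0; rewrite add0r.
have h2 : 0 < 2 + rdot g g by rewrite ltr_pwDl.
have := small (e / (2 + rdot g g)); rewrite divr_gt0 // => /(_ isT).
by rewrite divfK // gt_eqF.
Qed.

End RealRiesz.

(* Declared inside a section of [summability], hence not exported. *)
#[local] Existing Instance summability.totally_filter.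

(** * Series over a countable index set; measurability of sums and norms *)

Section Csum.
Import finmap.
Context (R : realType) (J : countType).
Implicit Types a b : J -> R[i].

Lemma csum_cvg a : csummable a ->
  summability.partial_sum (a : J -> R[i]^o) @ summability.totally -->
    (csum a : R[i]^o).
Proof. by []. Qed.

Lemma csum_unique a (l : R[i]) :
  summability.partial_sum (a : J -> R[i]^o) @ summability.totally --> (l : R[i]^o) ->
  csummable a /\ csum a = l.
Proof.
move=> h; split; first by apply/cvg_ex; exists l.
exact: (cvg_lim (@norm_hausdorff _ (R[i]^o : normedModType R[i])) h).
Qed.

Lemma csum_linear a b (k : R[i]) : csummable a -> csummable b ->
  csummable (fun j => k * a j + b j) /\
  csum (fun j => k * a j + b j) = k * csum a + csum b.
Proof.
move=> /csum_cvg ca /csum_cvg cb; apply: csum_unique.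
pose f := summability.partial_sum (a : J -> R[i]^o).
pose g := summability.partial_sum (b : J -> R[i]^o).
have E : summability.partial_sum (fun j => k * a j + b j : R[i]^o) =
    (fun A => k *: f A + g A).
  apply/funext => A; rewrite /f /g /summability.partial_sum.
  rewrite big_split scaler_sumr; reflexivity.
rewrite E.
have c : (fun A => k *: f A + g A) @ summability.totally -->
    k *: (csum a : R[i]^o) + (csum b : R[i]^o).
  apply: (@cvgD R[i] R[i]^o); last exact: cb.
  by apply: (@cvgZl_tmp R[i] R[i]^o); exact: ca.
exact: c.
Qed.

(** Up to [e], the sum is a finite partial sum, whose real part is at most a finite subsum of [r].
    The bound lives in the extended reals, so it also covers a divergent sum of [r]. *)
Lemma Re_csum_le a (r : J -> R) : csummable a ->
  (forall j, `|complex.Re (a j)| <= r j) ->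
  (`|complex.Re (csum a)|%:E <= \esum_(j in [set: J]) (r j)%:E)%E.
Proof.
move=> /csum_cvg ca har.
apply/lee_addgt0Pr => e e0.
have e0' : 0 < e%:C :> R[i] by rewrite ltcR.
have [A _ hA] := @cvgr_dist_lt _ _ _ _ _ _ _ ca _ e0'.
(* The estimate holds for every finite set containing [A]; [A] itself is enough. *)
have /= {hA} := hA A (fsubset_refl A).
set s := summability.partial_sum _ _ => hs.
have h1 : `|complex.Re (csum a)| <= e + `|complex.Re s|.
  have h : `|complex.Re (csum a - s)| <= e.
    by rewrite -lecR; exact: le_trans (normc_ge_Re _) (ltW hs).
  have -> : csum a = (csum a - s) + s by rewrite subrK.
  rewrite complex_ReD; apply: le_trans (ler_normD _ _) _.
  by rewrite lerD2r.
apply: (@le_trans _ _ (e + `|complex.Re s|)%:E); first by rewrite lee_fin.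
rewrite EFinD addeC leeD2r //.
apply: esum_ge; exists [set` A]; first by split.
rewrite fsbig_finite //= set_fsetK.
rewrite /s /summability.partial_sum big_seq_fsetE /=.
rewrite sumEFin lee_fin.
elim/big_ind2 : _ => //.
- by rewrite normr0.
- by move=> x1 x2 y1 y2 h2 h3; rewrite complex_ReD (le_trans (ler_normD _ _)) // lerD.
Qed.

End Csum.

(** Coding [J] by natural numbers turns the sum into a nonnegative series over nat, which is
    measurable as a limit of partial sums. *)
Lemma measurable_fun_esum (R : realType) (d : measure_display) (X : measurableType d)
    (J : countType) (D : set X) (h : J -> X -> \bar R) :
  (forall j x, (0 <= h j x)%E) -> (forall j, measurable_fun D (h j)) ->
  measurable_fun D (fun x => \esum_(j in [set: J]) h j x)%E.
Proof.
move=> h0 mh.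
(* [pickle_inv] is [None] off the range of [pickle], so each index is counted exactly once and the
   other codes contribute 0. *)
pose k n : X -> \bar R := if pickle_inv n is Some j then h j else cst 0%E.
have k0 n x : (0 <= k n x)%E by rewrite /k; case: (pickle_inv n).
have mk n : measurable_fun D (k n).
  by rewrite /k; case: (pickle_inv n) => [j|]; [exact (mh j) | exact: measurable_cst].
rewrite (_ : (fun _ => _) = (fun x => \sum_(n <oo | n \in xpredT) k n x)%E).
  exact: ge0_emeasurable_sum.
apply/funext => x; rewrite nneseries_esumT; last by [].
transitivity (\esum_(n in range (@pickle J)) k n x)%E.
  rewrite (@reindex_esum _ J nat setT _ pickle) ; last by split.
  by apply: eq_esum => j _; rewrite /k pickleK_inv.
rewrite -[range _]setTI esum_mkcondr; apply: eq_esum => n _.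
case: ifPn => // /negP nr.
rewrite /k; case E : (pickle_inv n) => [j|//].
exfalso; apply: nr; apply/mem_set; exists j => //.
by have := @pickle_invK J n; rewrite E.
Qed.

(** Open rays generate the Borel sets of the line, and their preimages under the norm are open: if
    |v| > r, the ball of radius |v| - r around [v] stays in the preimage. *)
Lemma measurable_hnorm (R : realType) (d : measure_display) (X : measurableType d)
  (K : hilbertType R) (u : X -> K) : borel_measurable u ->
  measurable_fun setT (fun x => hnorm (u x)).
Proof.
move=> mu; apply: (measurability _ (RGenOInfty.measurableE R)) => // _ [_ [r ->] <-].
rewrite setTI.
rewrite (_ : _ @^-1` _ = u @^-1` [set v | r < hnorm v]); last first.
  by apply/seteqP; split => x /=; rewrite in_itv /= andbT.
apply: mu; rewrite openE => v /= rv.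
apply/nbhs_ballP; exists (hnorm v - r)%:C => /=; first by rewrite ltcR subr_gt0.
move=> w; rewrite -ball_normE /= hnormE ltcR => hw.
have : hnorm v <= hnorm (v - w) + hnorm w.
  by rewrite -lecR rmorphD /= -!hnormE -{1}(subrK w v) ler_normD.
lra.
Qed.

(** * Linearity of real and complex integrals *)

Section Integrals.
Context (R : realType) (d : measure_display) (X : measurableType d).
Context (mu : {measure set X -> \bar R}) (D : set X) (mD : measurable D).

(** The shape a f + b g + h is that of the real and imaginary parts of k F1 + F2. The identity is
    asked almost everywhere because series are added termwise only where they converge. *)
Lemma Rintegral_ae_linear (a b : R) (f g h e : X -> R) :
  mu.-integrable D (EFin \o f) -> mu.-integrable D (EFin \o g) ->
  mu.-integrable D (EFin \o h) -> mu.-integrable D (EFin \o e) ->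
  {ae mu, forall x, D x -> e x = a * f x + b * g x + h x} ->
  Rintegral mu D e = a * Rintegral mu D f + b * Rintegral mu D g + Rintegral mu D h.
Proof.
move=> If Ig Ih Ie ae_e.
have Iaf : mu.-integrable D (EFin \o (fun x => a * f x))
  by exact: (integrableZl mD a If).
have Ibg : mu.-integrable D (EFin \o (fun x => b * g x))
  by exact: (integrableZl mD b Ig).
have Iab : mu.-integrable D (EFin \o (fun x => a * f x + b * g x))
  by exact: (integrableD mD Iaf Ibg).
have Iabh : mu.-integrable D (EFin \o (fun x => a * f x + b * g x + h x))
  by exact: (integrableD mD Iab Ih).
rewrite -!RintegralZl // -!RintegralD //.
congr fine; apply: ae_eq_integral => //.
- exact: measurable_int Ie.
- exact: measurable_int Iabh.
- by apply: filterS ae_e => x + Dx => /(_ Dx) /= ->.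
Qed.

Lemma complex_integral_ae_linear (k : R[i]) (F1 F2 F3 : X -> R[i]) :
  complex_integrable mu D F1 -> complex_integrable mu D F2 ->
  complex_integrable mu D F3 ->
  {ae mu, forall x, D x -> F3 x = k * F1 x + F2 x} ->
  complex_integral mu D F3 = k * complex_integral mu D F1 + complex_integral mu D F2.
Proof.
move=> [R1 I1] [R2 I2] [R3 I3] ae_F3; rewrite /complex_integral.
rewrite (Rintegral_ae_linear (a := complex.Re k) (b := - complex.Im k)
  R1 I1 R2 R3); last first.
  apply: filterS ae_F3 => x + Dx => /(_ Dx) ->.
  by case: k (F1 x) (F2 x) => [? ?] [? ?] [? ?] /=; rewrite mulNr.
rewrite (Rintegral_ae_linear (a := complex.Re k) (b := complex.Im k)
  I1 R1 I2 I3); last first.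
  apply: filterS ae_F3 => x + Dx => /(_ Dx) ->.
  by case: k (F1 x) (F2 x) => [? ?] [? ?] [? ?] /=.
by case: k {ae_F3} => a b; rewrite mulNr.
Qed.

End Integrals.

(** * Riesz representation for conjugate-linear functionals *)

Section ComplexRiesz.
Context (R : realType) (H : hilbertType R).

(* By homogeneity, a quadratic upper bound amounts to boundedness. *)
Lemma riesz (phi : H -> R[i]) (a b : R) :
  (forall (k : R[i]) (g h : H), phi (k *: g + h) = k^*%C * phi g + phi h) ->
  0 < b -> (forall g, complex.Re (phi g) <= a + b * hnorm g ^+ 2) ->
  exists v : H, forall g, '[v, g] = phi g.
Proof.
move=> phiP b0 phi_le.
have phiD u v : phi (u + v) = phi u + phi v.
  by have := phiP 1 u v; rewrite scale1r conjc1 mul1r.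
have phi0 : phi 0 = 0.
  by apply: (@addIr _ (phi 0)); rewrite -phiD !add0r.
have phiZ k u : phi (k *: u) = k^*%C * phi u.
  by have := phiP k u 0; rewrite !addr0 phi0 addr0.
have [||g|v hv] := @real_riesz R H (fun g => complex.Re (phi g)) a b _ _ b0.
- by move=> u v; rewrite phiD complex_ReD.
- move=> t u; rewrite phiZ; case: (phi u) => x y /=; ring.
- by rewrite rdot_sqr.
exists v => g; apply/eqP; rewrite eq_complex; apply/andP; split; apply/eqP.
  exact: hv.
(* The imaginary parts follow from testing at i g, because Re (- i z) = Im z. *)
have := hv ('i%C *: g); rewrite phiZ /rdot linearZr_LR /=.
case: ('[v, g]) (phi g) => [x y] [x' y'] /=.
by rewrite !(mul0r, sub0r, mulN1r, opprK).
Qed.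

End ComplexRiesz.

(** * Pairing integrals and existence of weak integrals *)

Section Pairing.
Context (R : realType) (d : measure_display) (X : measurableType d).
Context (mu : {measure set X -> \bar R}) (J : countType) (H K : hilbertType R).
Context (L G : X -> J -> {linear H -> K}).

Lemma pairing_integrable_subset (D : set X) f g : measurable D ->
  pairing_integrable mu setT L G f g -> pairing_integrable mu D L G f g.
Proof.
move=> mD [hs [hR hI]]; split; first by apply: filterS hs => x + _ => /(_ I).
by split; [apply: integrableS hR | apply: integrableS hI].
Qed.

Lemma pairing_integral_setC (D : set X) f g : measurable D ->
  pairing_integrable mu setT L G f g ->
  pairing_integral mu setT L G f g =
  pairing_integral mu D L G f g + pairing_integral mu (~` D) L G f g.
Proof.
move=> mD [_ [hR hI]]; rewrite /pairing_integral /complex_integral -(setUv D).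
rewrite !Rintegral_setU ?setUv //; try exact: measurableC; exact/disj_setPCl.
Qed.

Lemma pairing_integral_linear (D : set X) f (k : R[i]) g h : measurable D ->
  pairing_integrable mu D L G f g -> pairing_integrable mu D L G f h ->
  pairing_integrable mu D L G f (k *: g + h) ->
  pairing_integral mu D L G f (k *: g + h) =
  k^*%C * pairing_integral mu D L G f g + pairing_integral mu D L G f h.
Proof.
move=> mD [sg ig] [sh ih] [_ igh].
apply: complex_integral_ae_linear => //.
apply: filterS2 sg sh => x sg sh Dx.
rewrite -(csum_linear _ (sg Dx) (sh Dx)).2; congr csum; apply/funext => j.
by rewrite linearP linearPr.
Qed.

(** Bound the integrand by [rdot_le] termwise, sum over j and integrate over [D]; the dominating
    function [S] is nonnegative, so [D] may then be enlarged to the whole space. *)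
Lemma Re_pairing_integral_le (D : set X) f g : measurable D ->
  (forall j, borel_measurable (fun x => L x j g)) ->
  (forall j, borel_measurable (fun x => G x j f)) ->
  pairing_integrable mu D L G f g ->
  ((complex.Re (pairing_integral mu D L G f g))%:E <=
     frame_integral mu G f + frame_integral mu L g)%E.
Proof.
move=> mD mL mG [hs [hR hI]].
have sqr_ge0E (V : normedModType R[i]) (v : V) : (0%E <= (hnorm v ^+ 2)%:E)%E.
  by rewrite lee_fin sqr_ge0.
have mesum (T : X -> J -> {linear H -> K}) e :
    (forall j, borel_measurable (fun x => T x j e)) ->
    measurable_fun setT
      (fun x => \esum_(j in [set: J]) (hnorm (T x j e) ^+ 2)%:E)%E.
  move=> mT; apply: measurable_fun_esum => // j.
  apply/measurable_EFinP; apply: measurable_funX; exact: measurable_hnorm.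
rewrite /frame_integral -ge0_integralD //; first last.
- exact: mesum.
- by move=> x _; exact: esum_ge0.
- exact: mesum.
- by move=> x _; exact: esum_ge0.
rewrite /= fineK; last exact: integrable_fin_num.
pose S (x : X) : \bar R := (\esum_(j in [set: J]) (hnorm (G x j f) ^+ 2)%:E +
  \esum_(j in [set: J]) (hnorm (L x j g) ^+ 2)%:E)%E.
have mS : measurable_fun setT S.
  exact: (emeasurable_funD (mesum G f mG) (mesum L g mL)).
have S0 x : (0 <= S x)%E by apply: adde_ge0; exact: esum_ge0.
rewrite -[leRHS]/(\int[mu]_x S x)%E.
(* The comparison takes place on [D], where the series converge almost everywhere. *)
apply: (@le_trans _ _ (\int[mu]_(x in D) S x)%E); last first.
  by apply: ge0_subset_integral.
apply: le_trans (lee_abs _) _; apply: le_trans (le_abse_integral _ mD _) _.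
  exact: measurable_int hR.
apply: ae_ge0_le_integral => //.
- by apply: measurableT_comp => //; exact: measurable_int hR.
- exact: measurable_funTS.
apply: filterS hs => x + Dx => /(_ Dx) sx.
rewrite /S -esumD //.
pose r j := hnorm (G x j f) ^+ 2 + hnorm (L x j g) ^+ 2.
apply: le_trans (Re_csum_le (r := r) sx _) _.
  by move=> j; rewrite /r -!rdot_sqr; exact: rdot_le.
by apply: le_esum => j _; rewrite EFinD.
Qed.

(** [weak_integral] is a choice by [get], so it has the defining property as soon as some vector
    does; [riesz] supplies one. *)
Lemma weak_integralP (D : set X) (f : H) (A B : R) : measurable D -> 0 < B ->
  (forall g, pairing_integrable mu D L G f g) ->
  (forall g, (complex.Re (pairing_integral mu D L G f g) <= A + B * hnorm g ^+ 2)) ->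
  is_weak_integral mu D L G f (weak_integral mu D L G f).
Proof.
move=> mD B0 hi hb.
have [v hv] := riesz (fun k g h => pairing_integral_linear mD (hi g) (hi h)
  (hi (k *: g + h))) B0 hb.
by apply: (@getPex _ [set v | is_weak_integral mu D L G f v]); exists v => g; split.
Qed.

End Pairing.

(** * The identity for a frame and its alternate dual *)

Theorem theorem3p10 (R : realType) (d : measure_display)
    (X : measurableType d) (mu : {measure set X -> \bar R}) (J : countType)
    (H K : hilbertType R) (Kxj : X -> J -> set K)
    (Kxj_closed : forall x j, closed_subspace (Kxj x j))
    (Lambda G : X -> J -> {linear H -> K})
    (Lambda_frame : semicontinuous_gframe mu Kxj Lambda)
    (G_dual : alternate_dual mu Kxj Lambda G)
    (pairing_measurable : forall (j : J) (f g : H),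
      complex_measurable setT (fun x => '[G x j f, Lambda x j g]))
    (X1 : set X) (X1_measurable : measurable X1) (f : H) :
  [/\ is_weak_integral mu X1 Lambda G f (weak_integral mu X1 Lambda G f),
      is_weak_integral mu (~` X1) Lambda G f
        (weak_integral mu (~` X1) Lambda G f) &
      pairing_integral mu (~` X1) Lambda G f f
        + `|weak_integral mu X1 Lambda G f| ^+ 2
      = (pairing_integral mu X1 Lambda G f f)^*
        + `|weak_integral mu (~` X1) Lambda G f| ^+ 2].
Proof.
have [_ mL [AL [BL [_ BL0 hL]]]] := Lambda_frame.
have [[_ mG [AG [BG [_ BG0 hG]]]] dual _] := G_dual.
have int_setT g := (dual f g).1.
have weakP D : measurable D ->
    is_weak_integral mu D Lambda G f (weak_integral mu D Lambda G f).
  (* With [f] fixed, the upper frame bound of [G] at [f] is the constant term, and that of [Lambda]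
     at [g] is the quadratic term. *)
  move=> mD; apply: (weak_integralP (A := BG * hnorm f ^+ 2) mD BL0).
    by move=> g; exact: pairing_integrable_subset.
  move=> g; rewrite -lee_fin; apply: le_trans (Re_pairing_integral_le mD _ _ _) _ => //.
    exact: pairing_integrable_subset.
  by rewrite EFinD; apply: leeD; [exact: (hG f).2 | exact: (hL g).2].
have w1 := weakP _ X1_measurable.
have w2 := weakP _ (measurableC X1_measurable).
split=> //.
set v1 := weak_integral mu X1 Lambda G f in w1 *.
set v2 := weak_integral mu (~` X1) Lambda G f in w2 *.
have f_split : f = v1 + v2.
  apply: is_weak_integral_unique (dual f) _ => g; split; first exact: int_setT.
  by rewrite linearDl /= (w1 g).2 (w2 g).2 -pairing_integral_setC.
(* Testing the weak integrals at g = f turns the pairing integrals into <v1, f> and <v2, f>. *)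
rewrite -(w1 f).2 -(w2 f).2 !sqr_norm_dotp.
have -> : '[v1, f]^*%R = '[f, v1] by rewrite [RHS]hermC /= expr0 mul1r.
rewrite [in '[v2, f]]f_split [in '[f, v1]]f_split linearDr linearDl /=.
by rewrite addrC addrA.
Qed.
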